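(* Let $\lambda$ be a partition and $n\in N(\lambda)$. In infinitely many variables $x=(x_1,x_2,\dots)$, \[\mathrm{ss}_{\lambda,n}(x)=\sum_{O\in\mathrm{OT}_n(\lambda)}F_{\mathrm{des}\,O}(x).\]
   Context: Partitions are Young diagrams (English convention); a box is a position $(i,j)$, $i$ = row, $j$ = column. For boxes $B_1=(i_1,j_1)$, $B_2=(i_2,j_2)$ write $B_1<_{nE}B_2$ if $i_1\ge i_2$ and $j_1<j_2$. A skew shape is a horizontal strip if it has at most one box in each column. $N(\lambda)=\{n\ge|\lambda|: n\equiv|\lambda|\pmod 2\}$. Compositions: weak (nonnegative parts, trailing zeros ignored) and strong (positive parts). For a weak composition $c$, $\flat(c)$ deletes its zero parts, and $x^c=\prod_i x_i^{c_i}$. For a strong composition $b$, $M_b(x)=\sum_{c:\ \flat(c)=b}x^c$. A strong composition $b$ refines $a=(a_1,\dots,a_m)$ if it is obtained by splitting each $a_j$, in order, into positive parts summing to $a_j$; $\mathrm{ref}(a)$ is the set of such $b$ (including $a$), and $F_a(x)=\sum_{b\in\mathrm{ref}(a)}M_b(x)$ is the fundamental quasi-symmetric function. For partitions write $\nu\lhd\mu$ if $\nu\subset\mu$, $|\mu|=|\nu|+1$. An oscillating tableau (OT) of shape $\lambda$ and length $n$ is $O=(O_0,\dots,O_n)$ with $O_0=\emptyset$, $O_n=\lambda$, and for each $j\in[n]$ either $O_{j-1}\lhd O_j$ ($j$ an addition) or $O_j\lhd O_{j-1}$ ($j$ a deletion); $B_j$ is the box where $O_{j-1},O_j$ differ;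 $\mathrm{OT}_n(\lambda)$ is the set of these. Descent composition: split $\{1,\dots,n\}$ into consecutive blocks, where $1$ starts a block and, for $2\le j\le n$, $j$ is in the same block as $j-1$ iff (a) $j-1,j$ are both additions and $B_{j-1}<_{nE}B_j$, or (b) both are deletions and $B_j<_{nE}B_{j-1}$, or (c) $j-1$ is a deletion and $j$ an addition. $\mathrm{des}\,O$ is the sequence of block lengths. An SSOT of shape $\lambda$ is a sequence of partitions $S=(S^1,S'^2,S^2,S'^3,\dots)$ such that, with $S^0=S'^1=\emptyset$: for all $i\ge1$, $S'^i\subseteq S^{i-1}$, $S'^i\subseteq S^i$, and $S^{i-1}/S'^i$, $S^i/S'^i$ are horizontal strips (possibly empty); and $S^i=S'^{i+1}=\lambda$ for all large $i$. Put $m_i(S)=|S^{i-1}/S'^i|+|S^i/S'^i|$, length $n=\sum_im_i(S)$, $x^S=\prod_ix_i^{m_i(S)}$. $\mathrm{SSOT}_n(\lambda)$ is the set of SSOTs of shape $\lambda$ and length $n$, and $\mathrm{ss}_{\lambda,n}(x)=\sum_{S\in\mathrm{SSOT}_n(\lambda)}x^S$. *)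

(* Defs.v *)
From HB Require Import structures.
From mathcomp Require Import all_boot all_order all_algebra finmap.
From mathcomp Require Import mathcomp_extra boolp classical_sets functions.
From mathcomp Require Import cardinality fsbigop.

Set Implicit Arguments.
Unset Strict Implicit.
Unset Printing Implicit Defensive.

Import Order.TTheory GRing.Theory Num.Theory.

Local Open Scope classical_set_scope.
Local Open Scope nat_scope.

Definition is_intpart (s : seq nat) : bool := sorted geq s && (0 \notin s).

Record intpart := IntPart { parts :> seq nat; _ : is_intpart parts }.

HB.instance Definition _ := [isSub for parts].
HB.instance Definition _ := [Countable of intpart by <:].

Definition empty_part : intpart := @IntPart [::] isT.

(* Rows and columns are numbered from 0. *)
Definition box := (nat * nat)%type.

Definition in_diagram (la : intpart) (b : box) : bool := b.2 < nth 0 la b.1.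

Definition nE (b1 b2 : box) : bool := (b2.1 <= b1.1) && (b1.2 < b2.2).

Definition subpart (mu la : intpart) : Prop :=
  forall b, in_diagram mu b -> in_diagram la b.

Definition in_skew (la mu : intpart) (b : box) : bool :=
  in_diagram la b && ~~ in_diagram mu b.

(* |la / mu|, used only when [subpart mu la] *)
Definition skew_size (la mu : intpart) : nat := sumn la - sumn mu.

Definition horizontal_strip (la mu : intpart) : Prop :=
  forall i1 i2 j, in_skew la mu (i1, j) -> in_skew la mu (i2, j) -> i1 = i2.

Definition covered (nu mu : intpart) : Prop :=
  subpart nu mu /\ sumn mu = (sumn nu).+1.

Definition N_ (la : intpart) : set nat :=
  [set n | sumn la <= n /\ n = sumn la %[mod 2]].

(* A weak composition c; since Rocq indices start at 0, [c i] is the exponent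
   of the variable x_(i+1). *)
Definition wcomp := {fsfun nat -> nat with 0}.

(* A formal power series in x_1, x_2, ... is its family of coefficients. *)
Definition powseries := wcomp -> int.

Definition flat (c : wcomp) : seq nat := [seq c i | i <- sort leq (finsupp c)].

(* The monomial x^e, for a finitely supported exponent function e (the zero
   series for any other e). *)
Definition monomial (e : nat -> nat) : powseries :=
  fun c => if `[< forall i, c i = e i >] then 1%R else 0%R.

(* A formal sum of power series is meaningful when every coefficient receives
   only finitely many nonzero contributions. *)
Definition summable (I : choiceType) (A : set I) (f : I -> powseries) : Prop :=
  forall c, finite_set (A `&` [set a | f a c != 0%R]).

Definition psum (I : choiceType) (A : set I) (f : I -> powseries) : powseries :=
  fun c => (\sum_(a \in A) f a c)%R.

Definition M_ (b : seq nat) : powseries :=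
  psum [set c : wcomp | flat c = b] monomial.

Definition ref (a : seq nat) : set (seq nat) :=
  [set b | 0 \notin b /\
     exists bs : seq (seq nat), flatten bs = b /\ map sumn bs = a].

Definition F_ (a : seq nat) : powseries := psum (ref a) M_.

Section OscillatingTableaux.
Variable n : nat.
Implicit Type O : n.+1.-tuple intpart.

Definition ot_nth O (j : nat) : intpart := nth empty_part O j.

Definition addition O (j : nat) : Prop := covered (ot_nth O j.-1) (ot_nth O j).
Definition deletion O (j : nat) : Prop := covered (ot_nth O j) (ot_nth O j.-1).

Definition OT (la : intpart) : set (n.+1.-tuple intpart) :=
  [set O | [/\ ot_nth O 0 = empty_part, ot_nth O n = la &
             forall j, 1 <= j <= n -> addition O j \/ deletion O j]].

Definition step_box O (j : nat) : box :=
  xget (0, 0) [set b | in_diagram (ot_nth O j.-1) b != in_diagram (ot_nth O j) b].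

Definition same_block O (j : nat) : Prop :=
  [\/ [/\ addition O j.-1, addition O j & nE (step_box O j.-1) (step_box O j)],
      [/\ deletion O j.-1, deletion O j & nE (step_box O j) (step_box O j.-1)] |
      deletion O j.-1 /\ addition O j].

Definition block_starts O : seq nat :=
  [seq j <- iota 1 n | (j == 1) || ~~ `[< same_block O j >]].

(* The block starts s_1 = 1 < ... < s_k, followed by s_(k+1) = n + 1, yield
   the block lengths s_(i+1) - s_i. *)
Definition des O : seq nat :=
  pairmap (fun s t => t - s) 1 (behead (rcons (block_starts O) n.+1)).

End OscillatingTableaux.
Arguments OT : clear implicits.

(* The sequence (S^0, S'^1, S^1, S'^2, S^2, ...) is a function S on nat, with
   S^i = S (2 i) and S'^i = S (2 i - 1) for i >= 1. *)
Definition ssot_seq := nat -> intpart.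

Definition upper (S : ssot_seq) (i : nat) : intpart := S i.*2.
Definition lower (S : ssot_seq) (i : nat) : intpart := S i.*2.-1.

Definition is_ssot (la : intpart) (S : ssot_seq) : Prop :=
  [/\ upper S 0 = empty_part, lower S 1 = empty_part,
      forall i, 1 <= i ->
        [/\ subpart (lower S i) (upper S i.-1), subpart (lower S i) (upper S i),
            horizontal_strip (upper S i.-1) (lower S i) &
            horizontal_strip (upper S i) (lower S i)] &
      exists K, forall i, K <= i -> upper S i = la /\ lower S i.+1 = la].

Definition ssot_mult (S : ssot_seq) (i : nat) : nat :=
  skew_size (upper S i.-1) (lower S i) + skew_size (upper S i) (lower S i).

Definition ssot_length (S : ssot_seq) : nat :=
  (\sum_(i \in [set i : nat | (1 <= i)%N]) ssot_mult S i)%R.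

Definition SSOT (n : nat) (la : intpart) : set ssot_seq :=
  [set S | is_ssot la S /\ ssot_length S = n].

Definition ssot_monomial (S : ssot_seq) : powseries :=
  monomial (fun i => ssot_mult S i.+1).

Definition ss (la : intpart) (n : nat) : powseries :=
  psum (SSOT n la) ssot_monomial.

(* All the sums above are meaningful. *)

Lemma finite_bounded_seq (T : eqType) (A : set T) (N : nat) :
  finite_set A ->
  finite_set [set s : seq T | size s <= N /\ {in s, forall x, A x}].
Proof.
move=> finA; elim: N => [|N IHN].
  apply: (sub_finite_set _ (finite_set1 [::])) => s [] /=.
  by rewrite leqn0 => /nilP.
apply: (@sub_finite_set _ _ ([set [::]] `|` [set x :: s | x in A & s in
    [set s : seq T | size s <= N /\ {in s, forall x, A x}]])); last first.
  by rewrite finite_setU; split; [exact: finite_set1|exact: finite_image2].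
move=> [|x s] [/= szs As]; first by left.
right; exists x; first by apply: As; rewrite inE eqxx.
exists s => //; split=> // y ys; by apply: As; rewrite inE ys orbT.
Qed.

Lemma leq_sumn (s : seq nat) x : x \in s -> x <= sumn s.
Proof.
elim: s => //= y s IHs; rewrite inE => /predU1P[->|/IHs]; first exact: leq_addr.
by move/leq_trans; apply; apply: leq_addl.
Qed.

Lemma leq_size_sumn (s : seq nat) : 0 \notin s -> size s <= sumn s.
Proof.
elim: s => //= x s IHs; rewrite inE negb_or eq_sym -lt0n => /andP[x0 /IHs].
by move=> les; rewrite -add1n leq_add.
Qed.

Lemma finite_strong_seq N :
  finite_set [set s : seq nat | 0 \notin s /\ sumn s <= N].
Proof.
apply: sub_finite_set (finite_bounded_seq N (finite_II N.+1)) => s /= [s0 sN].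
split; first exact: leq_trans (leq_size_sumn s0) sN.
by move=> x /leq_sumn xs; rewrite /= ltnS (leq_trans xs).
Qed.

Lemma finite_intpart N : finite_set [set la : intpart | sumn la <= N].
Proof.
have inj : {in parts @^-1` [set s : seq nat | 0 \notin s /\ sumn s <= N] &,
    injective parts} by move=> x y _ _; exact: val_inj.
apply: sub_finite_set (finite_preimage inj (finite_strong_seq N)).
by move=> [s /= /andP[? ?]] ?; split.
Qed.

Lemma sumn_wide (s : seq nat) N :
  size s <= N -> sumn s = (\sum_(i < N) nth 0 s i)%N.
Proof.
elim: s N => [|x s IHs] [|N] //= sN.
- by rewrite big_ord0.
- by rewrite big1 // => i _; rewrite nth_nil.
- by rewrite big_ord_recl (IHs N).
Qed.

Lemma subpart_nth (mu la : intpart) i :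
  subpart mu la -> nth 0 mu i <= nth 0 la i.
Proof.
move=> sub; case E: (nth 0 mu i) => [//|k].
by have := sub (i, k); rewrite /in_diagram /= E; apply.
Qed.

Lemma intpart_nth_inj (mu la : intpart) :
  (forall i, nth 0 mu i = nth 0 la i) -> mu = la.
Proof.
have pos (p : intpart) : 0 \notin (p : seq nat) by case: p => s /= /andP[].
move=> st; apply: val_inj => /=.
have szle (u v : intpart) : (forall i, nth 0 u i = nth 0 v i) ->
    size u <= size v.
  move=> uv; rewrite leqNgt; apply/negP => vu; case/negP: (pos u).
  by rewrite -(nth_default 0 (leqnn (size v))) -uv mem_nth.
apply: (@eq_from_nth _ 0) => [|i _]; last exact: st.
by apply/eqP; rewrite eqn_leq !szle.
Qed.

Lemma sumn_subpart (mu la : intpart) : subpart mu la -> sumn mu <= sumn la.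
Proof.
move=> sub; rewrite (@sumn_wide mu (maxn (size mu) (size la)) (leq_maxl _ _)).
rewrite (@sumn_wide la (maxn (size mu) (size la)) (leq_maxr _ _)).
by apply: leq_sum => i _; apply: subpart_nth.
Qed.

Lemma skew_size_eq0 (mu la : intpart) :
  subpart mu la -> skew_size la mu = 0 -> mu = la.
Proof.
move=> sub /eqP; rewrite subn_eq0 => lela; apply: intpart_nth_inj => i.
have [iN|Ni] := ltnP i (maxn (size mu) (size la)); last first.
  by rewrite geq_max in Ni; case/andP: Ni => *; rewrite !nth_default.
have /leqif_sum : forall j : 'I_(maxn (size mu) (size la)), true ->
    nth 0 mu j <= nth 0 la j ?= iff (nth 0 mu j == nth 0 la j).
  by move=> j _; apply/leqif_eq/subpart_nth.
rewrite -(sumn_wide (leq_maxl _ _)) -(sumn_wide (leq_maxr _ _)) => -[_].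
rewrite eqn_leq lela sumn_subpart // => /esym/forallP.
by move/(_ (Ordinal iN)) => /eqP.
Qed.

Lemma summable_M b : summable [set c : wcomp | flat c = b] monomial.
Proof.
move=> c; apply: sub_finite_set (finite_set1 c) => c' [_] /=.
rewrite /monomial; case: asboolP => [cc' _|]; last by rewrite eqxx.
by apply/fsfunP => i; rewrite cc'.
Qed.

Lemma finite_ref a : finite_set (ref a).
Proof.
apply: sub_finite_set (finite_strong_seq (sumn a)) => b /= [b0 [bs [bE <-]]].
by split=> //; rewrite -bE sumn_flatten.
Qed.

Lemma finite_OT n la : finite_set (OT n la).
Proof.
have inj : {in @tval n.+1 intpart @^-1` [set s : seq intpart |
      size s <= n.+1 /\ {in s, forall mu, [set mu : intpart | sumn mu <= n] mu}]
    &, injective (@tval n.+1 intpart)} by move=> O O' _ _; exact: val_inj.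
apply: sub_finite_set
  (finite_preimage inj (finite_bounded_seq n.+1 (finite_intpart n))).
move=> O [O0 _ Ostep] /=; split; first by rewrite size_tuple.
have Oj j : j <= n -> sumn (ot_nth O j) <= j.
  elim: j => [|j IHj] jn; first by rewrite O0.
  have := IHj (ltnW jn); case: (Ostep j.+1 jn) => -[_ /= ->] //.
  by move/ltnW/leq_trans; apply.
move=> mu /(nthP empty_part)[j]; rewrite size_tuple ltnS => jn <-.
exact: leq_trans (Oj _ jn) jn.
Qed.

Lemma finite_ssot_mult la S : is_ssot la S ->
  finite_set [set i | ssot_mult S i != 0].
Proof.
move=> [_ _ _ [K SK]]; apply: sub_finite_set (finite_II K.+1) => i /=.
rewrite ltnS; apply: contraNT; rewrite -ltnNge; case: i => // i Ki.
have [Ui Li] := SK i Ki; have [Ui1 _] := SK i.+1 (leqW Ki).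
by rewrite /ssot_mult /skew_size /= Ui Li Ui1 subnn.
Qed.

Lemma summable_ss n la : summable (SSOT n la) ssot_monomial.
Proof.
move=> c.
have [K cK] : exists K, forall i, K <= i -> c i = 0.
  exists (\max_(i <- finsupp c) i).+1 => i; rewrite leqNgt => iK.
  apply/eqP; apply: contraNT iK; rewrite -mem_finsupp => ic.
  by rewrite ltnS; apply: leq_bigmax_seq.
pose B := (\sum_(i < K) c i)%N.
pose trunc (S : ssot_seq) := mkseq S K.*2.+1.
set X := _ `&` _.
have XP S : X S -> [/\ is_ssot la S & forall i, ssot_mult S i.+1 = c i].
  case=> -[Sla _]; rewrite /ssot_monomial /monomial /=.
  by case: asboolP => [cS _|_]; rewrite ?eqxx //; split.
have tail S i : X S -> K <= i -> upper S i = la /\ lower S i.+1 = la.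
  move=> /XP[[_ _ Sstep [L SL]] Sc] Ki.
  have st j : K <= j -> lower S j.+1 = upper S j /\ lower S j.+1 = upper S j.+1.
    move=> Kj; have [//|sub1 sub2 _ _] := Sstep j.+1.
    have /eqP := Sc j; rewrite cK // addn_eq0 => /andP[/eqP z1 /eqP z2].
    by split; apply: skew_size_eq0.
  have Ui : upper S i = la.
    have -> : upper S i = upper S (i + L).
      elim: L {SL} => [|L ->]; first by rewrite addn0.
      by rewrite addnS; have [<- ->] := st _ (leq_trans Ki (leq_addr L i)).
    by have [] := SL (i + L) (leq_addl _ _).
  by split=> //; have [-> _] := st i Ki.
have inj : {in X &, injective trunc}.
  move=> S T /set_mem XS /set_mem XT eqST; apply/funext => j.
  have [jK|Kj] := ltnP j K.*2.+1.
    by rewrite -(nth_mkseq empty_part S jK) -(nth_mkseq empty_part T jK) -/(trunc _) eqST.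
  have tailj R : X R -> R j = la.
    move=> XR; rewrite -(odd_double_half j); have := Kj.
    rewrite -{1}(odd_double_half j); case: (odd j) => /=; rewrite ?add1n ?add0n.
      by rewrite ltnS leq_double => /(tail _ _ XR)[].
    by move/ltnW; rewrite leq_double => /(tail _ _ XR)[].
  by rewrite !tailj.
have bound S j : X S -> j <= K.*2 -> sumn (S j) <= B.
  move=> /XP[[S0 _ Sstep _] Sc].
  have Uj i : i <= K -> sumn (upper S i) <= (\sum_(k < i) c k)%N.
    elim: i => [|i IHi] iK; first by rewrite S0.
    have [//|sub1 sub2 _ _] := Sstep i.+1.
    rewrite big_ord_recr /= -Sc /ssot_mult /skew_size /=.
    have := IHi (ltnW iK); have := sumn_subpart sub1; have := sumn_subpart sub2.
    rewrite /=; move: (sumn _) (sumn _) (sumn _) => u l u' lu lu' u's.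
    rewrite -{1}(subnK lu) addnC.
    by rewrite addnA leq_add2r (leq_trans (leq_trans lu' u's)) // leq_addr.
  have leB i : i <= K -> (\sum_(k < i) c k)%N <= B.
    by move=> iK; rewrite /B (big_ord_widen _ _ iK) big_mkcond leq_sum // => k _; case: ifP.
  rewrite -(odd_double_half j); case: (odd j) => /=; rewrite ?add1n ?add0n => jK.
    have /andP [jK1 jK2]: (j./2 <= K) && (j./2.+1 <= K).
      by rewrite -ltn_double jK -leq_double ltnW.
    have [//|sub1 _ _ _] := Sstep j./2.+1.
    by apply: leq_trans (sumn_subpart sub1) (leq_trans (Uj _ jK1) (leB _ jK1)).
  rewrite leq_double in jK; exact: leq_trans (Uj _ jK) (leB _ jK).
have fin : finite_set [set s : seq intpart | size s <= K.*2.+1 /\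
    {in s, forall mu, [set mu : intpart | sumn mu <= B] mu}].
  exact: finite_bounded_seq (finite_intpart B).
have finT : finite_set (trunc @` X).
  apply: sub_finite_set fin => _ [S XS <-]; split=> [|mu]; first by rewrite /trunc size_mkseq.
  by move=> /mapP[j]; rewrite mem_iota ltnS => /= jK ->; apply: bound.
by rewrite -(eq_finite_set (inj_card_eq inj)).
Qed.

(* Main.v *)
(* Comparing coefficients of x^c, one must match the SSOTs of weight c with the
   oscillating tableaux O such that flat c refines des O, i.e. such that all
   indices strictly inside a segment (c_1 + ... + c_(i-1), c_1 + ... + c_i]
   continue a block.  Inside one block deletions precede additions, and the
   deleted boxes decrease while the added ones increase for <_nE.  Such a
   run of additions from kappa to mu exists iff mu / kappa is a horizontal
   strip, and is then unique, since the box with the largest column must come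
   last; runs of deletions are reversed runs of additions.  Hence a segment
   from mu to nu is the same thing as its smallest partition kappa, with
   mu / kappa and nu / kappa horizontal strips, i.e. one step of an SSOT. *)
Require Import Defs.
From mathcomp Require Import all_boot all_algebra finmap zify.
From mathcomp Require Import boolp classical_sets functions fsbigop.

Set Implicit Arguments.
Unset Strict Implicit.
Unset Printing Implicit Defensive.

Local Open Scope nat_scope.

(** * Partitions as weakly decreasing row lengths *)

Lemma intpart_row_anti (la : intpart) i j :
  i <= j -> nth 0 la j <= nth 0 la i.
Proof.
elim: j => [|j IHj]; first by rewrite leqn0 => /eqP->.
rewrite leq_eqVlt => /predU1P[->//|/IHj]; apply: leq_trans.
have [jla|/(nth_default 0)->//] := ltnP j.+1 (size la).
case: la jla {IHj} => s /= /andP[/(sortedP 0) s_geq _]; exact: s_geq.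
Qed.

(** Parts must be positive, so the bound [N] is lowered until the last row kept is nonzero;
    monotonicity then makes all earlier rows nonzero. *)
Lemma intpart_of_rows (h : nat -> nat) N :
  (forall i, h i.+1 <= h i) -> (forall i, N <= i -> h i = 0) ->
  exists la : intpart, forall i, nth 0 la i = h i.
Proof.
move=> hanti; elim: N => [|N IHN] h0.
  by exists empty_part => i; rewrite h0 // nth_nil.
have hle i j : i <= j -> h j <= h i.
  elim: j => [|j IHj]; first by rewrite leqn0 => /eqP->.
  by rewrite leq_eqVlt => /predU1P[->//|/IHj]; apply: leq_trans.
case: (posnP (h N)) => [hN|hN].
  by apply: IHN => i; rewrite leq_eqVlt => /predU1P[<-|/h0].
have hP : is_intpart (mkseq h N.+1).
  apply/andP; split.
    apply/(sortedP 0) => i; rewrite size_mkseq => iN.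
    by rewrite !nth_mkseq ?(ltnW iN) //; apply: hanti.
  apply/mapP => -[i]; rewrite mem_iota ltnS => /hle; lia.
exists (IntPart hP) => i /=; have [iN|Ni] := ltnP i N.+1.
  exact: nth_mkseq.
by rewrite nth_default ?size_mkseq // h0.
Qed.

Lemma subpartP (mu la : intpart) :
  subpart mu la <-> forall i, nth 0 mu i <= nth 0 la i.
Proof.
split=> [sub i|le [i j]]; first exact: subpart_nth.
by move/leq_trans; apply; apply: le.
Qed.

Lemma subpart_trans (mu nu la : intpart) :
  subpart mu nu -> subpart nu la -> subpart mu la.
Proof. by move=> munu nula b /munu/nula. Qed.

Lemma subpart_empty (mu : intpart) : subpart mu empty_part -> mu = empty_part.
Proof.
by move=> sub; apply: skew_size_eq0 => //; rewrite /skew_size /= sub0n.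
Qed.

(** Interlacing form of the strip condition. If it fails at [i], column [nth 0 mu i] has skew boxes
    in rows [i] and [i.+1]; if it holds, skew boxes below row [i1] lie in columns smaller than
    [nth 0 mu i1]. *)
Lemma horizontal_stripP (mu la : intpart) : subpart mu la ->
  horizontal_strip la mu <-> forall i, nth 0 la i.+1 <= nth 0 mu i.
Proof.
move=> /subpartP sub; split=> [strip i|le i1 i2 j].
  rewrite leqNgt; apply/negP => lt.
  have lai := @intpart_row_anti la i i.+1 (leqnSn i).
  have mui := @intpart_row_anti mu i i.+1 (leqnSn i).
  have := strip i i.+1 (nth 0 mu i); rewrite /in_skew /in_diagram /=.
  have := sub i.+1; lia.
rewrite /in_skew /in_diagram /=.
wlog lt12 : i1 i2 / i1 < i2.
  move=> wlg; case: (ltngtP i1 i2) => // [/wlg//|/wlg wlg' ? ?].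
  by apply/esym/wlg'.
have := @intpart_row_anti la i1.+1 i2 lt12; have := le i1; lia.
Qed.

(** * Adding a single box *)

(** Containment makes the row differences nonnegative; as they sum to 1, exactly one of them is
    1. *)
Lemma coveredP (nu mu : intpart) :
  covered nu mu <-> exists r, forall i, nth 0 mu i = nth 0 nu i + (i == r).
Proof.
split=> [[/subpartP sub eqS]|[r rowE]].
  pose N := maxn (size nu) (size mu).
  have Enu := sumn_wide (leq_maxl (size nu) (size mu)).
  have Emu := sumn_wide (leq_maxr (size nu) (size mu)).
  have /eqP : \sum_(i < N) (nth 0 mu i - nth 0 nu i) = 1.
    by rewrite sumnB // -Emu -Enu eqS subSnn.
  move=> /sum_nat_eq1[r [_ r1 rest]]; exists (nat_of_ord r) => i.
  have [iN|Ni] := ltnP i N.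
    have := sub i; case: (eqVneq i (nat_of_ord r)) => [->|ir].
      by have := sub r; lia.
    have := rest (Ordinal iN) ir isT => /=; lia.
  have := ltn_ord r; move: Ni; rewrite geq_max => /andP[nui mui].
  rewrite !nth_default //; lia.
split; first by apply/subpartP => i; rewrite rowE leq_addr.
pose N := maxn r.+1 (maxn (size nu) (size mu)).
rewrite (@sumn_wide nu N) ?(@sumn_wide mu N); try by rewrite /N; lia.
have rN : r < N by rewrite /N; lia.
rewrite (eq_bigr (fun i : 'I_N => nth 0 nu i + (i == Ordinal rN))).
  rewrite big_split /= -addn1; congr addn; apply/eqP/sum_nat_eq1.
  by exists (Ordinal rN); split=> [||i /negbTE->] //; rewrite eqxx.
by move=> i _; rewrite rowE.
Qed.

(** Convertible to [step_box] when the arguments are consecutive entries of a tableau. Being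
    symmetric, it serves additions and deletions alike. *)
Definition diff_box (nu mu : intpart) : box :=
  xget (0, 0) [set b | in_diagram nu b != in_diagram mu b]%classic.

Lemma diff_boxC (nu mu : intpart) : diff_box nu mu = diff_box mu nu.
Proof.
by congr xget; apply/seteqP; split=> b /=; rewrite eq_sym.
Qed.

Lemma diff_box_row (nu mu : intpart) r :
  (forall i, nth 0 mu i = nth 0 nu i + (i == r)) ->
  diff_box nu mu = (r, nth 0 nu r).
Proof.
move=> rowE; apply: xget_unique => /=.
  by rewrite /in_diagram rowE eqxx /=; lia.
move=> [i j]; rewrite /in_diagram /= rowE.
by case: (i =P r) => [-> ne|_]; [congr pair; lia|lia].
Qed.

Lemma diff_box_unique (nu mu : intpart) b : covered nu mu ->
  in_skew mu nu b -> b = diff_box nu mu.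
Proof.
move=> /coveredP[r rowE]; rewrite (diff_box_row rowE).
case: b => i j; rewrite /in_skew /in_diagram /= rowE.
by case: (i =P r) => [-> ne|_]; [congr pair; lia|lia].
Qed.

Lemma diff_box_skew (nu mu : intpart) : covered nu mu ->
  in_skew mu nu (diff_box nu mu).
Proof.
move=> /coveredP[r rowE]; rewrite (diff_box_row rowE).
by rewrite /in_skew /in_diagram /= rowE eqxx; lia.
Qed.

Lemma covered_inj (nu nu' mu : intpart) : covered nu mu -> covered nu' mu ->
  diff_box nu mu = diff_box nu' mu -> nu = nu'.
Proof.
move=> /coveredP[r rowE] /coveredP[r' rowE'].
rewrite (diff_box_row rowE) (diff_box_row rowE') => -[rr' _].
apply: intpart_nth_inj => i; have := rowE i; rewrite rowE' rr'; lia.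
Qed.

Lemma covered_asym (nu mu : intpart) : covered nu mu -> ~ covered mu nu.
Proof. by move=> [_ lt] [_]; lia. Qed.

(** * Runs of additions and horizontal strips *)

(** Positions are counted from 0, so that runs of additions, and runs of deletions read backwards,
    all become chains of this one form. *)
Definition ne_chain (g : nat -> intpart) d : Prop :=
  (forall j, j < d -> covered (g j) (g j.+1)) /\
  (forall j, j.+1 < d ->
    nE (diff_box (g j) (g j.+1)) (diff_box (g j.+1) (g j.+2))).

Lemma ne_chain_pred g d : ne_chain g d.+1 -> ne_chain g d.
Proof. by move=> [gcov gne]; split=> j jd; [apply: gcov|apply: gne]; lia. Qed.

(** Columns strictly increase along a chain, so the last box is the strictly rightmost one. *)
Lemma ne_chain_skew g d b : ne_chain g d.+1 -> in_skew (g d.+1) (g 0) b ->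
  b = diff_box (g d) (g d.+1) \/ b.2 < (diff_box (g d) (g d.+1)).2.
Proof.
elim: d => [|d IHd] gch /andP[bin bout].
  by left; apply: diff_box_unique; [exact: gch.1|apply/andP].
have [bd|bd] := boolP (in_diagram (g d.+1) b); last first.
  left; apply: diff_box_unique; last exact/andP.
  by exact: gch.1.
right; have /andP[_ lt] := gch.2 d (ltnSn _).
have [|->//|] := IHd (ne_chain_pred gch); first exact/andP.
by move/ltn_trans; apply.
Qed.

(** By induction, each new box opens a column to the right of all earlier boxes, so no column is
    used twice. *)
Lemma ne_chain_strip g d : ne_chain g d ->
  [/\ subpart (g 0) (g d), horizontal_strip (g d) (g 0) &
      sumn (g d) = sumn (g 0) + d].
Proof.
elim: d => [|d IHd] gch.
  by split; [|move=> ? ? ? /andP[->]|rewrite addn0].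
have [sub strip szE] := IHd (ne_chain_pred gch).
have [subS szS] := gch.1 d (ltnSn d).
split; [exact: subpart_trans subS|move=> i1 i2 j sk1 sk2|lia].
have old i : in_skew (g d.+1) (g 0) (i, j) ->
    (i, j) = diff_box (g d) (g d.+1) \/ in_skew (g d) (g 0) (i, j).
  move=> /andP[iin iout]; have [iD|iD] := boolP (in_diagram (g d) (i, j)).
    by right; apply/andP.
  left; apply: diff_box_unique; last exact/andP.
  by exact: gch.1.
have lastN i b : in_skew (g d) (g 0) (i, j) -> b = diff_box (g d) (g d.+1) ->
    b.2 <> j.
  move=> sk -> jE; case: d {IHd strip szE old sk1 sk2 subS szS sub} gch sk jE.
    by move=> _ /andP[->].
  move=> d gch sk jE; have /andP[_] := gch.2 d (ltnSn _); rewrite jE.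
  by case: (ne_chain_skew (ne_chain_pred gch) sk) => [<-|] /=; lia.
case: (old _ sk1) => [e1|o1]; case: (old _ sk2) => [e2|o2].
- by move: e1; rewrite -e2 => -[].
- by case: (lastN _ _ o2 e1).
- by case: (lastN _ _ o1 e2).
- exact: strip o1 o2.
Qed.

(** Both last boxes are the rightmost box of the same skew shape, hence equal; removing it leaves
    shorter chains with the same ends. *)
Lemma ne_chain_unique g h d : ne_chain g d -> ne_chain h d ->
  g 0 = h 0 -> g d = h d -> forall j, j <= d -> g j = h j.
Proof.
elim: d => [|d IHd] gch hch gh0 ghd j.
  by rewrite leqn0 => /eqP->.
rewrite leq_eqVlt => /predU1P[->//|jd]; apply: IHd => //.
- exact: ne_chain_pred gch.
- exact: ne_chain_pred hch.
have gcov := gch.1 d (ltnSn d); have hcov := hch.1 d (ltnSn d).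
have lastS f : ne_chain f d.+1 -> in_skew (f d.+1) (f 0)
    (diff_box (f d) (f d.+1)).
  move=> fch; have /andP[bin bout] := diff_box_skew (fch.1 d (ltnSn d)).
  apply/andP; split=> //; apply: contra bout.
  by have [+ _ _] := ne_chain_strip (ne_chain_pred fch); apply.
have sg := lastS _ gch; have sh := lastS _ hch.
rewrite {1}ghd {1}gh0 in sg; rewrite -{1}ghd -{1}gh0 in sh.
suff eqB : diff_box (g d) (g d.+1) = diff_box (h d) (h d.+1).
  by rewrite ghd in gcov eqB; exact: covered_inj gcov hcov eqB.
(* Otherwise each of the two last boxes would be strictly left of the other. *)
have [-> //|lt] := ne_chain_skew gch sh.
have [-> //|lt'] := ne_chain_skew hch sg.
by move: lt lt'; lia.
Qed.

(** Induction on the number of boxes. The box added last ends the topmost row in which [mu] exceeds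
    [kappa]: interlacing makes it removable and puts every other skew box weakly below it and
    strictly to its left. *)
Lemma ne_chain_exists (kappa mu : intpart) :
  subpart kappa mu -> horizontal_strip mu kappa ->
  exists g, [/\ ne_chain g (skew_size mu kappa), g 0 = kappa &
                g (skew_size mu kappa) = mu].
Proof.
move: {2}(skew_size mu kappa) (erefl (skew_size mu kappa)) => d.
elim: d mu => [|d IHd] mu szE sub strip.
  by exists (fun=> mu); split=> //; rewrite ?szE // (skew_size_eq0 sub szE).
have /subpartP subr := sub.
have stripr := (horizontal_stripP sub).1 strip.
have exr : exists r, nth 0 kappa r < nth 0 mu r.
  apply: contrapT => nex; suff E : kappa = mu.
    by move: szE; rewrite E /skew_size subnn.
  apply: intpart_nth_inj => i; apply/eqP; rewrite eqn_leq subr leqNgt.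
  by apply/negP => lt; apply: nex; exists i.
case: (ex_minnP exr) => r rlt rmin.
have [nu nuE] : exists nu : intpart,
    forall i, nth 0 nu i = nth 0 mu i - (i == r).
  apply: (@intpart_of_rows _ (size mu)) => i; last first.
    by move/(nth_default 0)->; rewrite sub0n.
  have [->|ir] := eqVneq i r; last first.
    by have := intpart_row_anti mu (leqnSn i); lia.
  (* Row [r.+1] of [mu] is at most row [r] of [kappa], hence shorter than row [r] of [mu]. *)
  by have := stripr r; lia.
have cov : covered nu mu.
  by apply/coveredP; exists r => i; rewrite nuE; case: eqP => [->|]; lia.
have subnu : subpart kappa nu.
  apply/subpartP => i; rewrite nuE; have := subr i.
  by case: eqP => [->|]; lia.
have stripnu : horizontal_strip nu kappa.
  apply/(horizontal_stripP subnu) => i; rewrite nuE.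
  by have := stripr i; lia.
have sznu : skew_size nu kappa = d.
  move: szE; rewrite /skew_size cov.2; have := sumn_subpart subnu; lia.
have [g [gch g0 gd]] := IHd nu sznu subnu stripnu.
rewrite sznu in gch gd.
exists (fun j => if j <= d then g j else mu).
rewrite szE leq0n ltnn; split=> //; split=> j jd.
  have -> : j <= d by lia.
  case: ltnP => [/gch.1//|dj].
  by have -> : j = d; [lia|rewrite gd].
have -> : j <= d by lia.
have -> : j < d by lia.
case: ltnP => [/gch.2//|dj].
have dE : d = j.+1 by lia.
have mubox : diff_box nu mu = (r, (nth 0 mu r).-1).
  rewrite (@diff_box_row _ _ r) ?nuE ?eqxx ?subn1 // => i.
  by rewrite nuE; case: eqP => [->|]; lia.
rewrite -dE gd mubox; rewrite dE in gch.
(* The preceding box [(i, k)] lies outside [kappa], so minimality of [r] gives [r <= i]; interlacing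
   then bounds its column. *)
have /andP[] := diff_box_skew (gch.1 j (ltnSn j)).
rewrite -[in g j.+1]dE gd; case: (diff_box _ _) => i k.
have [sgj _ _] := ne_chain_strip (ne_chain_pred gch).
move=> kin kout; have {kout} : ~~ in_diagram kappa (i, k).
  by apply: contra kout; rewrite -g0; apply: sgj.
move: kin; rewrite /in_diagram /nE /= nuE => kin kout.
have ri : r <= i by apply: rmin; lia.
rewrite ri /=; move: kin; case: eqP => [->|/eqP ir]; first by lia.
have := stripr r; have := @intpart_row_anti mu r.+1 i; lia.
Qed.

(** * Ascending and descending runs on an interval of positions *)

(** The bounds number partitions, not steps, so that consecutive runs share an end. *)
Definition asc (f : nat -> intpart) a b : Prop :=
  (forall j, a <= j < b -> covered (f j) (f j.+1)) /\
  (forall j, a <= j -> j.+1 < b ->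
    nE (diff_box (f j) (f j.+1)) (diff_box (f j.+1) (f j.+2))).

Definition desc (f : nat -> intpart) a b : Prop :=
  (forall j, a <= j < b -> covered (f j.+1) (f j)) /\
  (forall j, a <= j -> j.+1 < b ->
    nE (diff_box (f j.+1) (f j.+2)) (diff_box (f j) (f j.+1))).

Lemma asc_chain f a b : a <= b ->
  asc f a b <-> ne_chain (fun j => f (a + j)) (b - a).
Proof.
move=> ab; split=> -[cov ne]; split=> j.
- by move=> jb; rewrite addnS; apply: cov; lia.
- by move=> jb; rewrite !addnS; apply: ne; lia.
- by move=> jb; have := cov (j - a); rewrite addnS subnKC; [apply|]; lia.
- move=> aj jb; have := ne (j - a); rewrite !addnS subnKC //; apply; lia.
Qed.

(** Reading backwards turns deletions into additions and leaves the boxes unchanged, by symmetry of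
    [diff_box]. *)
Lemma desc_chain f a b : a <= b ->
  desc f a b <-> ne_chain (fun j => f (b - j)) (b - a).
Proof.
move=> ab; split=> -[cov ne]; split=> j.
- move=> jb; have := cov (b - j.+1).
  by have -> : (b - j.+1).+1 = b - j; [|apply]; lia.
- move=> jb; have := ne (b - j.+2).
  have -> : (b - j.+2).+1 = b - j.+1 by lia.
  have -> : (b - j.+1).+1 = b - j by lia.
  by rewrite ![diff_box (f (b - j.+1)) _]diff_boxC
    (diff_boxC (f (b - j.+2))); apply; lia.
- move=> jb; have := cov (b - j.+1).
  have -> : b - (b - j.+1) = j.+1 by lia.
  by have -> : b - (b - j.+1).+1 = j; [|apply]; lia.
- move=> aj jb; have := ne (b - j.+2).
  have -> : b - (b - j.+2) = j.+2 by lia.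
  have -> : b - (b - j.+2).+1 = j.+1 by lia.
  have -> : b - (b - j.+2).+2 = j by lia.
  by rewrite (diff_boxC (f j.+2)) (diff_boxC (f j.+1) (f j)); apply; lia.
Qed.

Lemma eq_asc f g a b : (forall j, a <= j <= b -> f j = g j) ->
  asc f a b -> asc g a b.
Proof.
move=> fg [cov ne]; split=> j *; rewrite -!fg; try lia.
- by apply: cov; lia.
- by apply: ne; lia.
Qed.

Lemma eq_desc f g a b : (forall j, a <= j <= b -> f j = g j) ->
  desc f a b -> desc g a b.
Proof.
move=> fg [cov ne]; split=> j *; rewrite -!fg; try lia.
- by apply: cov; lia.
- by apply: ne; lia.
Qed.

Lemma asc_strip f a b : a <= b -> asc f a b ->
  [/\ subpart (f a) (f b), horizontal_strip (f b) (f a) &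
      sumn (f b) = sumn (f a) + (b - a)].
Proof.
move=> ab /(asc_chain _ ab)/ne_chain_strip /=.
by rewrite addn0 subnKC.
Qed.

Lemma desc_strip f a b : a <= b -> desc f a b ->
  [/\ subpart (f b) (f a), horizontal_strip (f a) (f b) &
      sumn (f a) = sumn (f b) + (b - a)].
Proof.
move=> ab /(desc_chain _ ab)/ne_chain_strip /=.
by rewrite subn0 subKn.
Qed.

Lemma asc_unique f g a b : asc f a b -> asc g a b ->
  f a = g a -> f b = g b -> forall j, a <= j <= b -> f j = g j.
Proof.
have [ab|ba] := leqP a b; last by move=> *; lia.
move=> /(asc_chain _ ab) fch /(asc_chain _ ab) gch fga fgb j jab.
have := ne_chain_unique fch gch; rewrite /= !addn0 !subnKC //.
by move=> /(_ fga fgb (j - a)); rewrite subnKC; [apply|]; lia.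
Qed.

Lemma desc_unique f g a b : desc f a b -> desc g a b ->
  f a = g a -> f b = g b -> forall j, a <= j <= b -> f j = g j.
Proof.
have [ab|ba] := leqP a b; last by move=> *; lia.
move=> /(desc_chain _ ab) fch /(desc_chain _ ab) gch fga fgb j jab.
have := ne_chain_unique fch gch; rewrite /= !subn0 !subKn //.
by move=> /(_ fgb fga (b - j)); rewrite subKn; [apply|]; lia.
Qed.

Lemma asc_exists (kappa mu : intpart) a b :
  subpart kappa mu -> horizontal_strip mu kappa ->
  b = a + skew_size mu kappa ->
  exists f, [/\ asc f a b, f a = kappa & f b = mu].
Proof.
move=> sub strip bE; have ab : a <= b by lia.
have [g [gch g0 gd]] := ne_chain_exists sub strip.
exists (fun j => g (j - a)); rewrite subnn bE addKn; split=> //.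
rewrite -bE; apply/(asc_chain _ ab); rewrite bE addKn.
by split=> j jd; rewrite !addKn; [exact: gch.1|exact: gch.2].
Qed.

Lemma desc_exists (kappa mu : intpart) a b :
  subpart kappa mu -> horizontal_strip mu kappa ->
  b = a + skew_size mu kappa ->
  exists f, [/\ desc f a b, f a = mu & f b = kappa].
Proof.
move=> sub strip bE; have ab : a <= b by lia.
have [g [gch g0 gd]] := ne_chain_exists sub strip.
exists (fun j => g (b - j)); rewrite subnn {3}bE addKn; split=> //.
apply/(desc_chain _ ab); rewrite bE addKn.
by split=> j jd; rewrite !subKn; try lia; [exact: gch.1|exact: gch.2].
Qed.

(** * Segments contained in one block *)

(* [same_block O j.+2], for an arbitrary sequence of partitions. *)
Definition joined (f : nat -> intpart) j : Prop :=
  [\/ [/\ covered (f j) (f j.+1), covered (f j.+1) (f j.+2) &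
          nE (diff_box (f j) (f j.+1)) (diff_box (f j.+1) (f j.+2))],
      [/\ covered (f j.+1) (f j), covered (f j.+2) (f j.+1) &
          nE (diff_box (f j.+1) (f j.+2)) (diff_box (f j) (f j.+1))] |
      covered (f j.+1) (f j) /\ covered (f j.+1) (f j.+2)].

Definition steps (f : nat -> intpart) a b : Prop :=
  forall j, a <= j < b -> covered (f j) (f j.+1) \/ covered (f j.+1) (f j).

(** No clause of [joined] lets a deletion follow an addition, so the deletions come first and [q] is
    where they end. The induction appends one step at the end. *)
Lemma joined_split f a b : a <= b -> steps f a b ->
  (forall j, a <= j -> j.+1 < b -> joined f j) ->
  exists2 q, a <= q <= b & desc f a q /\ asc f q b.
Proof.
have nil x : asc f x x /\ desc f x x by split; split=> j; lia.
have asc1 x : covered (f x) (f x.+1) -> asc f x x.+1.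
  move=> cov; split=> j *; last lia.
  by have -> : j = x by lia.
elim: b => [|b IHb] ab st jn.
  have a0 : a = 0 by lia.
  by exists 0; rewrite a0 //; case: (nil 0).
have [->|ab'] := eqVneq a b.+1.
  by exists b.+1; rewrite ?leqnn //; case: (nil b.+1).
have {ab'}ab : a <= b by lia.
have [q qab [fd fa]] : exists2 q, a <= q <= b & desc f a q /\ asc f q b.
  by apply: IHb => // j *; [apply: st|apply: jn]; lia.
have [qb|bq] := ltnP q b.
  exists q; first lia; split=> //; case: b qb {IHb ab} qab fa st jn => // b.
  move=> qb qab fa st jn.
  have covb : covered (f b) (f b.+1) by apply: fa.1; lia.
  (* The step before is an addition, which leaves only the first clause of [joined]. *)
  have [||[_ covb1 neb]|[/covered_asym]|[/covered_asym]] // := jn b; try lia.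
  split=> j *.
    by have [->//|jb] := eqVneq j b.+1; apply: fa.1; lia.
  by have [->//|jb] := eqVneq j b; apply: fa.2; lia.
(* There is no addition so far: the new step either opens the ascending run or prolongs the
   descending one. *)
have qE : q = b by lia.
move: fd fa; rewrite {}qE => fd fa {qab bq q}.
case: (st b); first lia.
  by exists b; [lia|split=> //; apply: asc1].
move=> covb; exists b.+1; [lia|split; last exact: (nil _).1].
split=> j *.
  by have [->//|jb] := eqVneq j b; apply: fd.1; lia.
have [jb|jb] := eqVneq j.+1 b; last by apply: fd.2; lia.
subst b; have covj : covered (f j.+1) (f j) by apply: fd.1; lia.
have [||[/(covered_asym covj)]|[_ _ //]|[_ /(covered_asym covb)]] // := jn j;
  lia.
Qed.

Lemma desc_asc_joined f a q b j : desc f a q -> asc f q b ->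
  a <= j -> j.+1 < b -> joined f j.
Proof.
move=> fd fa aj jb; case: (ltngtP j.+1 q) => jq.
- apply: Or32; split; [apply: fd.1|apply: fd.1|apply: fd.2]; lia.
- apply: Or31; split; [apply: fa.1|apply: fa.1|apply: fa.2]; lia.
- by apply: Or33; split; [apply: fd.1|apply: fa.1]; lia.
Qed.

Lemma desc_asc_steps f a q b : desc f a q -> asc f q b -> steps f a b.
Proof.
move=> fd fa j jab; have [jq|qj] := ltnP j q.
  by right; apply: fd.1; lia.
by left; apply: fa.1; lia.
Qed.

(** Neighbouring pieces overlap only in their common end, where they agree. *)
Lemma glue (T : Type) (r : nat -> nat) (g : nat -> nat -> T) K :
  (forall k, r k <= r k.+1) -> (forall k, g k (r k.+1) = g k.+1 (r k.+1)) ->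
  exists f, forall k, k < K -> forall j, r k <= j <= r k.+1 -> f j = g k j.
Proof.
move=> rS gS; elim: K => [|K [f fE]]; first by exists (g 0).
have rle i k : i <= k -> r i <= r k.
  elim: k => [|k IHk]; first by rewrite leqn0 => /eqP->.
  by rewrite leq_eqVlt => /predU1P[->//|/IHk]/leq_trans; apply.
exists (fun j => if j < r K then f j else g K j) => k kK j jk.
have [kK'|kK'] := ltnP k K; last first.
  have kE : k = K by lia.
  by rewrite -kE; case: ltnP => //; lia.
case: ltnP => jK; first exact: fE.
(* Pieces may have length 0, so [r K] can also end a piece before the neighbouring one; the previous
   [f] links the two. *)
have jE : j = r K by have := rle k.+1 K kK'; lia.
case: K kK kK' {jK rle} fE jE => // K kK kK' fE jE.
by rewrite jE -gS -(fE K) -?jE ?(fE k) // jE rS leqnn.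
Qed.

(** * Refinement and descent compositions through partial sums *)

Lemma sumn_take_le (s : seq nat) k l : k <= l ->
  sumn (take k s) <= sumn (take l s).
Proof. by move=> kl; rewrite -(subnKC kl) takeD sumn_cat leq_addr. Qed.

(** Cutting [b] into blocks with sums [a] means cutting it at the partial sums of [a]; the induction
    splits off the prefix of [b] that sums to the first part of [a]. *)
Lemma refP (a b : seq nat) : 0 \notin b ->
  ref a b <-> sumn a = sumn b /\
              forall k, exists l, sumn (take k a) = sumn (take l b).
Proof.
move=> b0; split=> [[_ [bs [<- <-]]]|].
  split=> [|k]; first by rewrite sumn_flatten.
  exists (size (flatten (take k bs))).
  by rewrite -map_take -sumn_flatten -{3}(cat_take_drop k bs) flatten_cat
    take_size_cat.
elim: a b b0 => [|x a IHa] b b0 [sE psum].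
  have := leq_size_sumn b0; rewrite -sE leqn0 => /nilP->.
  by split=> //; exists [::].
have [l xE] := psum 1; rewrite /= take0 addn0 in xE.
have bE := cat_take_drop l b.
have d0 : 0 \notin drop l b.
  by apply: contra b0 => d0; rewrite -bE mem_cat d0 orbT.
case: (IHa _ d0) => [|_ [bs [bsE bsa]]].
  split=> [|k]; first by move: sE; rewrite -{1}bE sumn_cat /= -xE; lia.
  have [l' /= kE] := psum k.+1.
  have [ll'|l'l] := leqP l l'.
    exists (l' - l); move: kE.
    by rewrite -{1}(subnKC ll') takeD sumn_cat -xE => /addnI.
  (* The first [k] terms of the remaining [a] then sum to 0. *)
  exists 0; rewrite take0; have := sumn_take_le b (ltnW l'l).
  by rewrite -kE -xE /=; lia.
by split=> //; exists (take l b :: bs); rewrite /= bsE bE -xE bsa.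
Qed.

Lemma mem_last_take (T : eqType) (x : T) s y :
  (exists k, last x (take k s) = y) <-> y \in x :: s.
Proof.
split=> [[k <-]|].
  have := mem_last x (take k s); rewrite !inE => /predU1P[->|/mem_take->].
    by rewrite eqxx.
  by rewrite orbT.
rewrite inE => /predU1P[->|ys]; first by exists 0; rewrite take0.
exists (index y s).+1.
by rewrite (take_nth x) ?index_mem // last_rcons nth_index.
Qed.

(** The differences telescope; sortedness keeps the truncated subtraction exact. *)
Lemma sumn_gaps x (s : seq nat) k : path leq x s ->
  x + sumn (take k (pairmap (fun s t => t - s) x s)) = last x (take k s).
Proof.
elim: s x k => [|y s IHs] x [|k] //=; rewrite ?addn0 // => /andP[xy ys].
by rewrite -(IHs _ _ ys); lia.
Qed.

(** Increased by 1, the partial sums of [des O] are the block starts and [n.+1] (for positive [n]).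
    Step [j.+2] starts a block iff [joined] fails at [j], and then [j.+1] steps precede it. *)
Lemma ref_desP n (O : n.+1.-tuple intpart) (b : seq nat) : 0 \notin b ->
  ref (des O) b <-> sumn b = n /\
    forall j, j.+2 <= n -> ~ joined (ot_nth O) j ->
      exists l, j.+1 = sumn (take l b).
Proof.
move=> b0; rewrite refP // /des.
(* For length 0 there is no block start and [des O] is empty. *)
case: n O => [|n] O.
  by split=> -[sE _]; split=> //= k; exists 0; rewrite take0.
pose rest := [seq j <- iota 2 n | ~~ `[< same_block O j >]].
have startsE : block_starts O = 1 :: rest.
  rewrite /block_starts /=; congr cons; apply: eq_in_filter => j.
  by rewrite mem_iota; case: eqP => // ->.
(* The length is [n.+1] from here on, so the entry closing the list of starts is [n.+2]. *)
rewrite startsE /=; set s := rcons rest n.+2.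
have path_s : path leq 1 s.
  suff : sorted leq (rcons (block_starts O) n.+2) by rewrite startsE.
  apply: (subseq_sorted leq_trans) (iota_sorted 1 n.+2).
  have -> : iota 1 n.+2 = rcons (iota 1 n.+1) n.+2.
    by rewrite -[n.+2 in LHS]addn1 iotaD cats1 add1n.
  by rewrite -!cats1 cat_subseq // filter_subseq.
set gaps := pairmap _ _ _.
have memP y : y \in 1 :: s <-> exists k, 1 + sumn (take k gaps) = y.
  rewrite -mem_last_take; split=> -[k <-]; exists k; last exact/esym/sumn_gaps.
  exact: sumn_gaps.
have sumE : sumn gaps = n.+1.
  have := sumn_gaps (size s) path_s.
  rewrite take_oversize ?size_pairmap // -/gaps take_size last_rcons; lia.
have memE j : j.+2 <= n.+1 -> (j.+2 \in rest) = ~~ `[< same_block O j.+2 >].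
  by move=> jn; rewrite mem_filter mem_iota; case: (~~ _) => //=; lia.
rewrite sumE; split=> -[bE psum]; split=> //.
- move=> j jn jnj.
  have : j.+2 \in 1 :: s.
    rewrite in_cons mem_rcons in_cons memE //; apply/or3P/Or33.
    exact/asboolPn.
  move=> /memP[k kE]; have [l lE] := psum k.
  by exists l; rewrite -lE; lia.
- move=> k; have : 1 + sumn (take k gaps) \in 1 :: s by apply/memP; exists k.
  rewrite in_cons mem_rcons in_cons => /or3P[/eqP kE|/eqP kE|].
  + by exists 0; rewrite take0 /=; lia.
  + by exists (size b); rewrite take_size; lia.
  + set y := 1 + _; rewrite mem_filter mem_iota => /andP[/asboolPn ynb yn].
    have [j jE] : exists j, y = j.+2 by exists y.-2; lia.
    rewrite jE in ynb yn; have [|l lE] := psum j _ ynb; first lia.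
    by exists l; rewrite -lE; lia.
Qed.

(** * Segments cut out by a weak composition *)

(** The exponent [c i] accounts for the steps of a tableau between positions [csum c i] and
    [csum c i.+1]. *)
Definition csum (c : wcomp) i := \sum_(k < i) c k.

Lemma csumS c i : csum c i.+1 = csum c i + c i.
Proof. exact: big_ord_recr. Qed.

Lemma csum_le c i j : i <= j -> csum c i <= csum c j.
Proof.
elim: j => [|j IHj]; first by rewrite leqn0 => /eqP->.
rewrite leq_eqVlt => /predU1P[->//|/IHj]; rewrite csumS; lia.
Qed.

Lemma wcomp_bound (c : wcomp) : exists K, forall i, K <= i -> c i = 0.
Proof.
exists (\max_(i <- finsupp c) i).+1 => i; rewrite leqNgt => iK.
apply/eqP; apply: contraNT iK; rewrite -mem_finsupp => ic.
by rewrite ltnS; apply: leq_bigmax_seq.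
Qed.

Lemma csum_const (c : wcomp) K i : (forall i, K <= i -> c i = 0) ->
  K <= i -> csum c i = csum c K.
Proof.
move=> cK; elim: i => [|i IHi]; first by rewrite leqn0 => /eqP->.
rewrite leq_eqVlt => /predU1P[->//|Ki].
by rewrite csumS cK // addn0 IHi.
Qed.

Lemma csum_seg (c : wcomp) j K : j < csum c K ->
  exists i, csum c i <= j < csum c i.+1.
Proof.
elim: K => [|K IHK]; first by rewrite /csum big_ord0.
by have [/IHK//|Kj jK] := ltnP j (csum c K); exists K; rewrite Kj jK.
Qed.

(** Trading the sorted support for an initial interval makes the partial sums of [flat c] comparable
    with [csum c]. *)
Lemma flatE (c : wcomp) K : (forall i, K <= i -> c i = 0) ->
  flat c = [seq x <- mkseq c K | x != 0].
Proof.
move=> cK; rewrite /mkseq filter_map /flat; congr map.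
apply: (sorted_eq leq_trans anti_leq).
- exact: (sort_sorted leq_total).
- exact: (sorted_filter leq_trans) (iota_sorted 0 K).
apply: uniq_perm; rewrite ?sort_uniq ?filter_uniq ?iota_uniq ?fset_uniq //.
move=> i; rewrite mem_sort mem_filter mem_iota /= mem_finsupp.
by case: ltnP => [|/cK->]; rewrite ?andbT.
Qed.

Lemma flat_neq0 c : 0 \notin flat c.
Proof.
have [K cK] := wcomp_bound c.
by rewrite (flatE cK) mem_filter.
Qed.

(** Deleting a zero only removes a repetition among the partial sums. *)
Lemma sumn_take_filter (s : seq nat) x :
  (exists l, x = sumn (take l [seq y <- s | y != 0])) <->
  (exists i, x = sumn (take i s)).
Proof.
elim: s x => [|y s IHs] x //=; case: (eqVneq y 0) => [->|y0] /=.
  rewrite IHs; split=> [[i ->]|[[|i] ->]]; first by exists i.+1.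
  - by exists 0; rewrite !take0.
  - by exists i.
split=> -[[|l] ->] /=; try by exists 0.
- have /IHs[i iE] : exists l', sumn (take l [seq y <- s | y != 0]) =
    sumn (take l' [seq y <- s | y != 0]) by exists l.
  by exists i.+1; rewrite /= -iE.
- have /IHs[i iE] : exists l', sumn (take l s) = sumn (take l' s) by exists l.
  by exists i.+1; rewrite /= -iE.
Qed.

Lemma sumn_mkseq (c : wcomp) i : sumn (mkseq c i) = csum c i.
Proof.
elim: i => [|i IHi]; first by rewrite /csum big_ord0.
rewrite /mkseq -addn1 iotaD map_cat sumn_cat -/(mkseq c i) IHi addn1.
by rewrite csumS /= addn0.
Qed.

Lemma sumn_take_flat (c : wcomp) x :
  (exists l, x = sumn (take l (flat c))) <-> (exists i, x = csum c i).
Proof.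
have [K cK] := wcomp_bound c; rewrite (flatE cK) sumn_take_filter.
have takeE i : i <= K -> sumn (take i (mkseq c K)) = csum c i.
  by move=> iK; rewrite /mkseq -map_take take_iota (minn_idPl iK) sumn_mkseq.
split=> -[i ->].
  have [/takeE->|/ltnW Ki] := leqP i K; first by exists i.
  by exists K; rewrite take_oversize ?size_mkseq // sumn_mkseq.
have [/takeE<-|/ltnW Ki] := leqP i K; first by exists i.
by exists K; rewrite takeE // (csum_const cK Ki).
Qed.

Lemma sumn_flat (c : wcomp) K : (forall i, K <= i -> c i = 0) ->
  sumn (flat c) = csum c K.
Proof.
move=> cK; rewrite (flatE cK) -sumn_mkseq.
by elim: (mkseq _ _) => //= x s <-; case: eqP => [->|].
Qed.

(** Blocks may break exactly at the values of [csum c]. Steps [j.+1] and [j.+2] meet at position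
    [j.+1], so they must be joined when that position is strictly inside a segment. *)
Lemma ref_des_flatP n (O : n.+1.-tuple intpart) (c : wcomp) K :
  (forall i, K <= i -> c i = 0) ->
  ref (des O) (flat c) <-> csum c K = n /\
    forall i j, csum c i <= j -> j.+1 < csum c i.+1 -> joined (ot_nth O) j.
Proof.
move=> cK; rewrite ref_desP ?flat_neq0 // (sumn_flat cK).
split=> -[KE jn]; split=> //.
  move=> i j ij ji; apply: contrapT => njn.
  have jn' : j.+2 <= n.
    have [iK|Ki] := leqP i.+1 K; first by have := csum_le c iK; lia.
    by move: ji; rewrite (csum_const cK (ltnW Ki)) KE.
  (* A value of [csum c] would lie strictly between two consecutive ones. *)
  have [i' i'E] := (sumn_take_flat c _).1 (jn _ jn' njn).
  have [ii'|i'i] := leqP i.+1 i'; first by have := csum_le c ii'; lia.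
  by have := @csum_le c i' i i'i; lia.
move=> j jlt njn; apply/sumn_take_flat.
have [|i /andP[ij ji]] := @csum_seg c j.+1 K; first by rewrite KE.
have [|ne] := eqVneq (csum c i) j.+1; first by exists i.
by case: njn; apply: (jn i) => //; lia.
Qed.

(** * Coefficients as sums of ones *)

(** In this form, coefficients can be compared by reindexing along a bijection. *)
Lemma fsum_indicator (I : choiceType) (A : set I) (P : I -> Prop) :
  (\sum_(x \in A) (if `[< P x >] then 1 else 0) =
   \sum_(x \in A `&` [set x | P x]) 1 :> int)%R%classic.
Proof.
rewrite -(@fsbig_widen _ _ _ _ (A `&` [set x | P x])%classic A).
- by apply: eq_fsbigr => x /set_mem[_ /= /asboolP->].
- by move=> x [].
- by move=> x [/= Ax nPx]; case: asboolP => // Px; case: nPx.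
Qed.

Lemma M_coef b c : M_ b c = (if `[< flat c = b >] then 1 else 0)%R.
Proof.
rewrite /M_ /psum fsum_indicator.
have cE (c' : wcomp) : (forall i, c i = c' i) -> c = c'.
  by move=> ?; apply/fsfunP.
case: asboolP => [cb|ncb].
  rewrite (_ : (_ `&` _)%classic = [set c]%classic) ?fsbig_set1 //.
  by apply/seteqP; split=> [c' [_ /= /cE->//]|_ ->].
by rewrite fsbig1 // => c' [/= c'b /cE ce]; case: ncb; rewrite ce.
Qed.

(** Among the series [M_ b], only the one with [b = flat c] contains the monomial of [c]. *)
Lemma F_coef a c : F_ a c = (if `[< ref a (flat c) >] then 1 else 0)%R.
Proof.
rewrite /F_ /psum (eq_fsbigr (fun b => if `[< flat c = b >] then 1 else 0)%R).
  rewrite fsum_indicator; case: asboolP => [cb|ncb].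
    rewrite (_ : (_ `&` _)%classic = [set flat c]%classic) ?fsbig_set1 //.
    by apply/seteqP; split=> [b [_ /= <-//]|_ ->].
  by rewrite fsbig1 // => b [/= + cb]; rewrite -cb.
by move=> b _; apply: M_coef.
Qed.

(** * The correspondence for a fixed weight *)

(* The index q at which deletions give way to additions in the segment from
   p = csum c i to p' = csum c i.+1, obtained from |f p| = |f q| + (q - p) and
   |f p'| = |f q| + (p' - q). *)
Definition turn (f : nat -> intpart) (c : wcomp) i : nat :=
  csum c i + (c i + sumn (f (csum c i)) - sumn (f (csum c i.+1)))./2.

(** The size equations leave twice [q - csum c i] under the halving, which is therefore exact. *)
Lemma turn_unique f c i q : csum c i <= q <= csum c i.+1 ->
  desc f (csum c i) q -> asc f q (csum c i.+1) -> turn f c i = q.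
Proof.
move=> /andP[pq qp'] /(desc_strip pq)[_ _ szd] /(asc_strip qp')[_ _ sza].
rewrite /turn szd sza; move: pq qp'; rewrite csumS; lia.
Qed.

(** The position in the tableau of entry [k] of the SSOT: entry [i.*2] is [upper] at [i], and entry
    [i.*2.+1] is [lower] at [i.+1]. *)
Definition breakpoint (f : nat -> intpart) (c : wcomp) k : nat :=
  if odd k then turn f c k./2 else csum c k./2.

Lemma breakpoint_even f c i : breakpoint f c i.*2 = csum c i.
Proof. by rewrite /breakpoint odd_double doubleK. Qed.

Lemma breakpoint_odd f c i : breakpoint f c i.*2.+1 = turn f c i.
Proof. by rewrite /breakpoint /= odd_double uphalf_double. Qed.

Definition coarsen (c : wcomp) n (O : n.+1.-tuple intpart) : ssot_seq :=
  fun k => ot_nth O (breakpoint (ot_nth O) c k).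

(** The tableaux that contribute to the coefficient at [c]; [SSOT_weight] is the counterpart for
    SSOTs. *)
Definition compatible_OT (la : intpart) n (c : wcomp) :
    set (n.+1.-tuple intpart) :=
  (OT n la `&` [set O | ref (des O) (flat c)])%classic.
Arguments compatible_OT : clear implicits.

Definition SSOT_weight (la : intpart) n (c : wcomp) : set ssot_seq :=
  (SSOT n la `&` [set S | forall i, c i = ssot_mult S i.+1])%classic.

Lemma csum_le_total (c : wcomp) K i : (forall i, K <= i -> c i = 0) ->
  csum c i <= csum c K.
Proof.
move=> cK; have [/csum_le//|/ltnW Ki] := leqP i K.
by rewrite (csum_const cK Ki).
Qed.

Lemma compatible_OT_segments la n c O i : compatible_OT la n c O ->
  let f := ot_nth O in
  [/\ csum c i <= turn f c i <= csum c i.+1, desc f (csum c i) (turn f c i) &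
      asc f (turn f c i) (csum c i.+1)].
Proof.
have [K cK] := wcomp_bound c.
move=> [[_ _ Ostep] /= /(ref_des_flatP _ cK)[KE jn]].
have [|||q qP [fd fa]] := @joined_split (ot_nth O) (csum c i) (csum c i.+1).
- by apply: csum_le.
- move=> j /andP[_ ji]; apply: (Ostep j.+1) => /=.
  by rewrite -KE; apply: leq_trans ji (csum_le_total _ cK).
- by move=> j; apply: jn.
by rewrite (turn_unique qP).
Qed.

Lemma ssot_length_csum S (c : wcomp) K : (forall i, K <= i -> c i = 0) ->
  (forall i, c i = ssot_mult S i.+1) -> ssot_length S = csum c K.
Proof.
move=> cK cS; rewrite /ssot_length.
rewrite (reindex_fsbig succn setT); last first.
  split=> [//|? ? _ _ []//|[//|i] _]; by exists i.
rewrite /csum -(fsbig_widen `I_K) //.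
  by rewrite -fsbig_ord; apply: eq_bigr => i _; rewrite cS.
by move=> i [_ /= /negP]; rewrite -leqNgt => /cK; rewrite cS.
Qed.

Lemma coarsen_ssot la n c O : compatible_OT la n c O ->
  SSOT_weight la n c (coarsen c O).
Proof.
move=> OB; have seg i := compatible_OT_segments i OB.
have [K cK] := wcomp_bound c.
have [[O0 On _] /= /(ref_des_flatP _ cK)[KE _]] := OB.
set f := ot_nth O in seg O0 On.
have upE i : upper (coarsen c O) i = f (csum c i).
  by rewrite /upper /coarsen breakpoint_even.
have loE i : lower (coarsen c O) i.+1 = f (turn f c i).
  by rewrite /lower /coarsen doubleS breakpoint_odd.
have strips i := let: And3 ti fd fa := seg i in
  (desc_strip (proj1 (andP ti)) fd, asc_strip (proj2 (andP ti)) fa).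
have mult i : c i = ssot_mult (coarsen c O) i.+1.
  rewrite /ssot_mult /= !upE loE /skew_size.
  have [/andP[pq qp'] _ _] := seg i.
  have [[_ _ szd] [_ _ sza]] := strips i.
  by have := csumS c i; lia.
have up0 : upper (coarsen c O) 0 = empty_part by rewrite upE /csum big_ord0.
split=> //; split; last by rewrite (ssot_length_csum cK mult).
split=> //.
- rewrite loE; apply: subpart_empty; rewrite -up0 upE.
  by have [[]] := strips 0.
- case=> // i _; rewrite /= !upE loE.
  by have [[sd hd _] [sa ha _]] := strips i.
(* Segments from [K] on are empty, so their turning point is [n] too. *)
- exists K => i Ki; rewrite upE loE (csum_const cK Ki) KE; split=> //.
  have [+ _ _] := seg i.
  rewrite (csum_const cK Ki) (csum_const cK (leqW Ki)) KE.
  by rewrite -eqn_leq => /eqP <-.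
Qed.

(** [turn] depends only on the sizes at the segment ends, so both tableaux turn at the same
    positions; each run is then determined by its two ends. *)
Lemma coarsen_inj la n c :
  {in compatible_OT la n c &, injective (@coarsen c n)}.
Proof.
move=> O O' /set_mem OB /set_mem OB' eqS.
have seg i := compatible_OT_segments i OB.
have seg' i := compatible_OT_segments i OB'.
have [K cK] := wcomp_bound c.
have [[O0 On _] /= /(ref_des_flatP _ cK)[KE _]] := OB.
have [[O'0 O'n _] _] := OB'.
set f := ot_nth O in seg O0 On; set f' := ot_nth O' in seg' O'0 O'n.
have up i : f (csum c i) = f' (csum c i).
  have : coarsen c O i.*2 = coarsen c O' i.*2 by rewrite eqS.
  by rewrite /coarsen !breakpoint_even.
have tE i : turn f c i = turn f' c i by rewrite /turn !up.
have lo i : f (turn f c i) = f' (turn f c i).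
  have : coarsen c O i.*2.+1 = coarsen c O' i.*2.+1 by rewrite eqS.
  by rewrite /coarsen !breakpoint_odd -/f -/f' -tE.
apply: val_inj; apply: (@eq_from_nth _ empty_part); rewrite ?size_tuple // => j.
rewrite ltnS leq_eqVlt => /predU1P[->|jn].
  by rewrite -![nth _ _ n]/(ot_nth _ n) -/f -/f' On O'n.
have [|i /andP[ij ji]] := @csum_seg c j K; first by rewrite KE.
have [ti fd fa] := seg i; have [_ fd' fa'] := seg' i; rewrite -tE in fd' fa'.
have [jt|tj] := leqP j (turn f c i).
  by apply: (desc_unique fd fd' (up i) (lo i)); rewrite ij.
by apply: (asc_unique fa fa' (lo i) (up i.+1)); rewrite (ltnW tj) ltnW.
Qed.

(** Each step of the SSOT is expanded into a descending run followed by an ascending one, and all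
    these runs are glued. *)
Lemma coarsen_surj la n c :
  set_surj (compatible_OT la n c) (SSOT_weight la n c) (@coarsen c n).
Proof.
move=> S [[[S0 S1 Sstep [L SL]] Slen] /= cS].
have [K cK] := wcomp_bound c.
have KE : csum c K = n by rewrite -Slen (ssot_length_csum cK cS).
(* From [M] on, [c] vanishes and the SSOT is constant. *)
pose M := maxn K L.
(* [w i] counts the deletions in segment [i], and [r] will turn out to be the [breakpoint] sequence
   of the tableau under construction. *)
pose w i := skew_size (upper S i) (lower S i.+1).
pose r k := csum c k./2 + (if odd k then w k./2 else 0).
have r_even i : r i.*2 = csum c i by rewrite /r odd_double doubleK addn0.
have r_odd i : r i.*2.+1 = csum c i + w i.
  by rewrite /r /= odd_double /= uphalf_double.
have r_next i :
    csum c i.+1 = r i.*2.+1 + skew_size (upper S i.+1) (lower S i.+1).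
  by rewrite r_odd csumS cS /ssot_mult /= addnA.
have pieces k : exists g,
    [/\ if odd k then asc g (r k) (r k.+1) else desc g (r k) (r k.+1),
        g (r k) = S k & g (r k.+1) = S k.+1].
  rewrite -(odd_double_half k).
  case: (odd k); rewrite ?add1n ?add0n /= odd_double /=.
    have [//|_ sub _ strip] := Sstep k./2.+1.
    by apply: asc_exists => //; rewrite -doubleS r_even r_next.
  have [//|sub _ strip _] := Sstep k./2.+1.
  by apply: desc_exists => //; rewrite r_even r_odd.
have [g gP] := choice pieces.
have rS k : r k <= r k.+1.
  rewrite -(odd_double_half k); case: (odd k); rewrite ?add1n ?add0n.
    by rewrite -doubleS r_even r_next leq_addr.
  by rewrite r_even r_odd leq_addr.
(* Piece [M.*2], of length 0 at position [n], is included so that [f n] is prescribed even when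
   [M = 0]. *)
have [k|f fE] := @glue intpart r g M.*2.+1 rS.
  by have [_ _ ->] := gP k; have [_ ->] := gP k.+1.
have cM i : M <= i -> csum c i = n.
  by move=> Mi; rewrite (csum_const cK) // (leq_trans (leq_maxl _ _) Mi).
have SM k : M.*2 <= k -> S k = la.
  rewrite -{2}(odd_double_half k) => Mk; have Lk : L <= k./2.
    by apply: leq_trans (leq_maxr K L) _; rewrite -/M; lia.
  by have [uE lE] := SL _ Lk; case: (odd k).
have rM k : M.*2 <= k -> r k = n.
  move=> Mk; rewrite /r cM; last lia.
  case: ifP; rewrite ?addn0 // /w /upper /lower => _.
  by rewrite !SM /skew_size ?subnn ?addn0 //; lia.
have fS k : f (r k) = S k.
  have atM : f (r M.*2) = S M.*2.
    by rewrite (fE M.*2) ?leqnn ?rS //; have [_ ->] := gP M.*2.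
  have [kM|Mk] := ltnP k M.*2.
    by rewrite (fE k) ?leqnn ?rS ?(leq_trans kM) //; have [_ ->] := gP k.
  by move: atM; rewrite !rM // !SM.
have segf i : [/\ csum c i <= r i.*2.+1 <= csum c i.+1,
    desc f (csum c i) (r i.*2.+1) & asc f (r i.*2.+1) (csum c i.+1)].
  rewrite -(r_even i) -(r_even i.+1) doubleS !rS; split=> //.
    (* Beyond the glued pieces the runs are empty. *)
    have [iM|Mi] := ltnP i M; last by rewrite !rM; [split=> j; lia|lia|lia].
    have [+ _ _] := gP i.*2; rewrite odd_double; apply: eq_desc => j jr.
    by apply/esym/fE => //; lia.
  have [iM|Mi] := ltnP i M; last by rewrite !rM; [split=> j; lia|lia|lia].
  have [+ _ _] := gP i.*2.+1; rewrite /= odd_double; apply: eq_asc => j jr.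
  by apply/esym/fE => //; lia.
pose O := [tuple of mkseq f n.+1].
have Of j : j <= n -> ot_nth O j = f j by move=> jn; rewrite /ot_nth nth_mkseq.
have csum_n i : csum c i <= n by rewrite -KE; apply: csum_le_total.
have segO i : desc (ot_nth O) (csum c i) (r i.*2.+1) /\
    asc (ot_nth O) (r i.*2.+1) (csum c i.+1).
  have [/andP[pq qp'] fd fa] := segf i; have := csum_n i.+1 => p'n.
  by split; [move: fd; apply: eq_desc|move: fa; apply: eq_asc] => j jr;
    rewrite Of //; lia.
exists O; last first.
  apply/funext => k; rewrite /coarsen.
  have -> : breakpoint (ot_nth O) c k = r k.
    rewrite -(odd_double_half k); case: (odd k); rewrite ?add1n ?add0n.
      have [od oa] := segO k./2; rewrite breakpoint_odd.
      by apply: turn_unique od oa; have [] := segf k./2.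
    by rewrite breakpoint_even r_even.
  rewrite Of ?fS // -(odd_double_half k).
  case: (odd k); rewrite ?add1n ?add0n ?r_even ?csum_n //.
  by have [/andP[_ rk] _ _] := segf k./2; apply: leq_trans rk _.
split; last first.
  apply/(ref_des_flatP _ cK); split=> // i j.
  by have [od oa] := segO i; apply: desc_asc_joined od oa.
split.
- by rewrite Of //; have := fS 0.*2; rewrite r_even /csum big_ord0 => ->.
- by rewrite Of // -(rM M.*2) // fS SM.
- case=> // j /= jn; have [|i ij] := @csum_seg c j K; first by rewrite KE.
  by have [od oa] := segO i; apply: desc_asc_steps od oa _ ij.
Qed.

Theorem theorem2p21 (la : intpart) (n : nat) (hn : N_ la n) :
  ss la n = psum (OT n la) (fun O => F_ (des O)).
Proof.
apply/funext => c; rewrite /ss /psum /ssot_monomial /monomial.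
rewrite fsum_indicator -/(SSOT_weight la n c).
(* The left coefficient is now a sum of ones over [SSOT_weight la n c], which [coarsen] carries over
   to tableaux. *)
rewrite (reindex_fsbig (@coarsen c n) (compatible_OT la n c)); last first.
  split; [exact: coarsen_ssot|exact: coarsen_inj|exact: coarsen_surj].
rewrite -fsum_indicator.
by apply: eq_fsbigr => O _; rewrite F_coef.
Qed.
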